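(* Let $k\geq 1$ be an integer and let $\mathcal{G}$ be the class of triangle-free graphs with treewidth at most $k$. Then the defective chromatic number of $\mathcal{G}$, the clustered chromatic number of $\mathcal{G}$, and the (proper) chromatic number of $\mathcal{G}$ all equal $\left\lceil \frac{k+3}{2}\right\rceil$.
   Context: Graphs are finite, simple and undirected. A $k$-colouring of a graph assigns one of at most $k$ colours to each vertex (not necessarily properly). A monochromatic component is a connected component of the subgraph induced by all vertices of a single colour. A colouring has defect $d$ if every monochromatic component has maximum degree at most $d$, and has clustering $c$ if every monochromatic component has at most $c$ vertices. For a graph class $\mathcal{G}$: the chromatic number of $\mathcal{G}$ is $\max\{\chi(G):G\in\mathcal{G}\}$, where $\chi(G)$ is the usual (proper) chromatic number; the defective chromatic number of $\mathcal{G}$ is the minimum integer $k$ for which there exists an integer $d$ such that every graph in $\mathcal{G}$ is $k$-colourable with defect $d$; the clustered chromatic number of $\mathcal{G}$ is the minimum integer $k$ for which there exists an integer $c$ such that every graph in $\mathcal{G}$ is $k$-colourable with clustering $c$. (Each is called unbounded if the relevant maximum or minimum does not exist.) Treewidth is the minimum, over all tree-decompositions, of the maximum bag size minus one. *)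

(* Defs.v *)
From mathcomp Require Import all_boot.
From mathcomp Require Import boolp.

Set Implicit Arguments.
Unset Strict Implicit.
Unset Printing Implicit Defensive.

Record sgraph := SGraph {
  vertex :> finType;
  adj : rel vertex;
  adj_sym : symmetric adj;
  adj_irrefl : irreflexive adj
}.

(** ** Induced subgraphs, connectedness, trees *)

Definition induced_adj (G : sgraph) (S : {set G}) : rel G :=
  [rel x y | [&& x \in S, y \in S & adj x y]].

Definition connected_in (G : sgraph) (S : {set G}) : Prop :=
  S != set0 /\ {in S &, forall x y, connect (induced_adj S) x y}.

Definition components (G : sgraph) (S : {set G}) : {set {set G}} :=
  [set [set y | connect (induced_adj S) x y] | x in S].

Definition max_degree_in (G : sgraph) (S : {set G}) : nat :=
  \max_(x in S) #|[set y in S | adj x y]|.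

(* The bound 2 is because x, y, x along an edge counts as a [cycle] of [adj]
   with two distinct vertices. *)
Definition acyclic (G : sgraph) : Prop :=
  forall c : seq G, cycle (@adj G) c -> uniq c -> size c <= 2.

Definition is_tree (T : sgraph) : Prop := connected_in [set: T] /\ acyclic T.

Definition triangle_free (G : sgraph) : Prop :=
  forall x y z : G, ~ [/\ adj x y, adj y z & adj x z].

(** ** Treewidth *)

Record tree_decomposition (G : sgraph) := TreeDecomposition {
  td_tree : sgraph;
  td_bag : td_tree -> {set G};
  td_treeP : is_tree td_tree;
  td_vertexP : forall v : G, connected_in [set t | v \in td_bag t];
  td_edgeP : forall x y : G, adj x y ->
    exists t : td_tree, x \in td_bag t /\ y \in td_bag t
}.

(* The subtraction truncates only for the graph without vertices, whose
   treewidth is thus 0 instead of -1. *)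
Definition td_width (G : sgraph) (D : tree_decomposition G) : nat :=
  (\max_(t : td_tree D) #|td_bag t|).-1.

Definition point_graph : sgraph :=
  @SGraph unit (fun _ _ => false) (fun _ _ => erefl) (fun _ => erefl).

Lemma point_graph_tree : is_tree point_graph.
Proof.
split; first split.
- by apply/set0Pn; exists tt; rewrite inE.
- by move=> [] [] _ _; exact: connect0.
- by move=> [|x [|y c]] //=.
Qed.

Definition trivial_td (G : sgraph) : tree_decomposition G.
Proof.
refine (@TreeDecomposition G point_graph (fun=> [set: G]) point_graph_tree _ _).
- move=> v; split; first by apply/set0Pn; exists tt; rewrite !inE.
  by move=> [] [] _ _; exact: connect0.
- by move=> x y _; exists tt; rewrite !inE.
Defined.

Lemma ex_td_width (G : sgraph) :
  exists w, `[< exists D : tree_decomposition G, td_width D = w >].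
Proof. by exists (td_width (trivial_td G)); apply/asboolP; eexists. Qed.

Definition treewidth (G : sgraph) : nat := ex_minn (ex_td_width G).

(** ** Colourings of a graph *)

Definition colouring (G : sgraph) (k : nat) := {ffun G -> 'I_k}.

Definition colour_class (G : sgraph) k (f : colouring G k) (i : 'I_k) :
  {set G} := [set x | f x == i].

Definition monochromatic_component (G : sgraph) k (f : colouring G k)
    (C : {set G}) : Prop :=
  exists i : 'I_k, C \in components (colour_class f i).

Definition has_defect (G : sgraph) k (f : colouring G k) (d : nat) : Prop :=
  forall C, monochromatic_component f C -> max_degree_in C <= d.

Definition has_clustering (G : sgraph) k (f : colouring G k) (c : nat) : Prop :=
  forall C, monochromatic_component f C -> #|C| <= c.

Definition proper (G : sgraph) k (f : colouring G k) : bool :=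
  [forall x, forall y, adj x y ==> (f x != f y)].

Lemma ex_proper (G : sgraph) : exists k, [exists f : colouring G k, proper f].
Proof.
exists #|G|; apply/existsP; exists [ffun x => enum_rank x].
apply/forallP=> x; apply/forallP=> y; apply/implyP=> xy.
rewrite !ffunE (inj_eq enum_rank_inj).
by apply/eqP=> exy; rewrite exy adj_irrefl in xy.
Qed.

Definition chi (G : sgraph) : nat := ex_minn (ex_proper G).

(** ** Chromatic numbers of a graph class

    These are relations: no [n] satisfies them when the number is unbounded. *)

Definition graph_class := sgraph -> Prop.

Definition is_min (P : nat -> Prop) (n : nat) : Prop :=
  P n /\ forall m, P m -> n <= m.

Definition is_max (P : nat -> Prop) (n : nat) : Prop :=
  P n /\ forall m, P m -> m <= n.

Definition is_chromatic_number (K : graph_class) (n : nat) : Prop :=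
  is_max (fun m => exists G, K G /\ chi G = m) n.

Definition is_defective_chromatic_number (K : graph_class) (n : nat) : Prop :=
  is_min (fun k => exists d : nat, forall G, K G ->
    exists f : colouring G k, has_defect f d) n.

Definition is_clustered_chromatic_number (K : graph_class) (n : nat) : Prop :=
  is_min (fun k => exists c : nat, forall G, K G ->
    exists f : colouring G k, has_clustering f c) n.

Definition triangle_free_tw (k : nat) : graph_class :=
  fun G => triangle_free G /\ treewidth G <= k.

(* Main.v *)
Require Import Defs.
From mathcomp Require Import all_boot.
From mathcomp Require Import boolp zify.

(* Let n = uphalf (k + 3).

   Upper bound: colour a triangle-free graph of treewidth at most k bag by bag, keeping each bag
   properly coloured and free of stable sets that meet all n colours. A set of colours with no
   stable system of representatives in X contains such a set C with at least 2|C| - 2 vertices of X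
   coloured in C; since a bag minus a vertex has at most k <= 2n - 3 vertices, this density leaves
   a colour for the next vertex that preserves the invariant.

   Lower bound: let c = n - 1, so that 2(c - 1) <= k, and consider c-colourings of defect d. Adding
   to a bag many vertices with the same stable neighbourhood N forces one of them to avoid the
   colours of N. Given a stable set I with i < c distinct colours, add vertices w_1, w_2, ... one at
   a time, w_j being adjacent to the vertices of I whose colours occur on w_1, ..., w_(j-1). The w_j
   are pairwise non-adjacent and have distinct colours, so one of them gets a colour not in I; then
   w_1, ..., w_j and the vertices of I not adjacent to w_j form a stable set with i + 1 colours. Bags
   have at most 2i + 1 vertices. A vertex adjacent to a stable set with all c colours is impossible. *)

Set Implicit Arguments.
Unset Strict Implicit.
Unset Printing Implicit Defensive.

(** * Stable systems of representatives *)

Definition stable (G : sgraph) (S : {set G}) : bool :=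
  [forall x in S, forall y in S, ~~ adj x y].

Lemma stableP (G : sgraph) (S : {set G}) :
  reflect {in S &, forall x y, ~~ adj x y} (stable S).
Proof.
apply: (iffP forall_inP) => [H x y xS yS | H x xS]; first exact: (forall_inP (H x xS)).
by apply/forall_inP => y yS; apply: H.
Qed.

Lemma stableS (G : sgraph) (S S' : {set G}) : S \subset S' -> stable S' -> stable S.
Proof.
by move=> /subsetP sub /stableP st; apply/stableP => x y /sub xS /sub yS; apply: st.
Qed.

Section Blocked.

Variables (G : sgraph) (n : nat).
Implicit Types (f : G -> 'I_n) (X J : {set G}) (C : {set 'I_n}).

(** [X] has no stable system of representatives for the colours in [C]. With [C = setT] this is the
    invariant kept on bags; a smaller blocked [C] certifies it. *)
Definition blocked f X C : Prop :=
  forall J, J \subset X -> stable J -> ~~ (C \subset f @: J).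

Lemma blockedS f X X' C C' :
  X' \subset X -> C \subset C' -> blocked f X C -> blocked f X' C'.
Proof.
move=> sX sC bl J JX' stJ; apply: contra (bl J (subset_trans JX' sX) stJ).
exact: subset_trans.
Qed.

(** Induction on the size of [C]. If every colour of [C] occurs twice in [X], then [C] itself is
    dense. A colour [c] with a single vertex [x] forces [x] into every system, so the non-neighbours
    of [x] block [C :\ c]. The set found there either already blocks in [X], or some neighbour of
    [x] has one of its colours; then [x] and that neighbour pay for adding [c]. *)
Lemma blocked_dense f X C : blocked f X C ->
  exists C', [/\ C' \subset C, blocked f X C' &
    2 * #|C'| <= #|[set x in X | f x \in C']| + 2].
Proof.
move: {2}#|C| (leqnn #|C|) => m; elim: m X C => [|m IH] X C.
  rewrite leqn0 cards_eq0 => /eqP -> bl; exists set0.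
  by split=> //; rewrite cards0.
move=> Cm bl.
pose cl c := [set x in X | f x == c].
case: (boolP [forall c in C, 1 < #|cl c|]) => [/forall_inP big | ].
  exists C; split=> //.
  have -> : #|[set x in X | f x \in C]| = \sum_(c in C) #|cl c|.
    rewrite -sum1_card (partition_big f (mem C)) /=; last by move=> x; rewrite inE => /andP[].
    apply: eq_bigr => c cC; rewrite -sum1_card; apply: eq_bigl => x; rewrite !inE.
    by case: eqP => [->|_]; rewrite ?cC ?andbT ?andbF.
  rewrite mulnC -sum_nat_const; apply: leq_trans (leq_addr _ _).
  exact: leq_sum.
rewrite negb_forall => /existsP[c]; rewrite negb_imply -leqNgt => /andP[cC clc].
have [cl0 | [x xcl]] := set_0Vmem (cl c).
  (* A colour missing from [X] is blocked by itself; [2 * 1 <= 0 + 2] uses up the additive 2 of the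
     bound. *)
  exists [set c]; split; rewrite ?sub1set ?cards1 //; last by rewrite addnC leq_addr.
  move=> J /subsetP JX _; rewrite sub1set; apply/imsetP => -[y yJ cE].
  suff: y \in cl c by rewrite cl0 inE.
  by rewrite inE (JX y yJ) -cE eqxx.
have clE : cl c = [set x].
  by apply/eqP; rewrite eq_sym eqEcard sub1set xcl cards1.
have [xX /eqP fx] : x \in X /\ f x == c by apply/andP; move: xcl; rewrite inE.
have xonly y : y \in X -> f y = c -> y = x.
  by move=> yX fy; apply/set1P; rewrite -clE inE yX fy eqxx.
pose X' := [set y in X | ~~ adj x y].
have X'X : X' \subset X by apply/subsetP => y; rewrite inE => /andP[].
have blocked_add C'' : blocked f X' C'' -> blocked f X (c |: C'').
  move=> bl'' J JX stJ; rewrite subUset sub1set negb_and.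
  case: (boolP (c \in _)) => //= /imsetP[y yJ cE]; apply: bl'' => //.
  have yx : y = x by apply: xonly => //; apply: (subsetP JX).
  apply/subsetP => z zJ; rewrite inE (subsetP JX) //=.
  by apply: (stableP _ stJ) => //; rewrite -yx.
have bl' : blocked f X' (C :\ c).
  move=> J JX' stJ; apply/negP => sub.
  have stxJ : stable (x |: J).
    apply/stableP => y z; rewrite !inE.
    move=> /predU1P[->|yJ] /predU1P[->|zJ]; rewrite ?adj_irrefl //.
    - by move: (subsetP JX' z zJ); rewrite inE => /andP[].
    - by move: (subsetP JX' y yJ); rewrite inE adj_sym => /andP[].
    - exact: (stableP _ stJ).
  have xJX : x |: J \subset X by rewrite subUset sub1set xX (subset_trans JX').
  apply: (negP (bl _ xJX stxJ)); apply/subsetP => e eC; rewrite imsetU1 !inE fx.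
  by case: eqP => //= /eqP ec; apply: (subsetP sub); rewrite !inE ec.
have [|C'' [C''C bl'' card'']] := IH X' (C :\ c) _ bl'.
  by move: Cm; rewrite (cardsD1 c) cC.
have C''C' : C'' \subset C by apply: subset_trans C''C (subsetDl _ _).
have cC'' : c \notin C''.
  by apply/negP => /(subsetP C''C); rewrite !inE eqxx.
have sub'' : [set y in X' | f y \in C''] \subset [set y in X | f y \in C''].
  by apply/subsetP => y; rewrite !inE -andbA => /and3P[-> _ ->].
have [/eqP eqX | neX] := boolP ([set y in X' | f y \in C''] == [set y in X | f y \in C'']).
  exists C''; split; rewrite -?eqX // => J JX stJ; apply/negP => sub.
  have JX' : [set y in J | f y \in C''] \subset X'.
    apply: subset_trans (_ : [set y in X' | f y \in C''] \subset X').
      by rewrite eqX; apply/subsetP => y; rewrite !inE => /andP[/(subsetP JX) -> ->].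
    by apply/subsetP => y; rewrite inE => /andP[].
  have stJ' : stable [set y in J | f y \in C''].
    by apply: stableS stJ; apply/subsetP => y; rewrite inE => /andP[].
  apply: (negP (bl'' _ JX' stJ')); apply/subsetP => e eC.
  have /imsetP[y yJ eE] := subsetP sub _ eC.
  by apply/imsetP; exists y => //; rewrite inE yJ -eE.
exists (c |: C''); split; first by rewrite subUset sub1set cC.
  exact: blocked_add.
have lt'' : #|[set y in X' | f y \in C'']| < #|[set y in X | f y \in C'']|.
  by apply: proper_card; rewrite properEneq neX.
have le'' : #|x |: [set y in X | f y \in C'']| <= #|[set y in X | f y \in c |: C'']|.
  apply/subset_leq_card/subsetP => y; rewrite !inE.
  by case/predU1P => [->|/andP[-> ->]]; rewrite ?xX ?fx ?eqxx ?orbT.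
move: le''; rewrite !cardsU1 cC'' inE fx (negbTE cC'') andbF; lia.
Qed.

(* If a dense blocked set of colours of non-neighbours of [v] and the colours of the neighbours
   exhaust all colours, then either some colour is missing on the non-neighbours, and any [a] not
   on the neighbours will do, or [#|A| >= 2 * n - 2]. *)
Lemma blocked_choice f (A : {set G}) (v : G) :
  triangle_free G -> blocked f A setT -> #|A| + 3 <= 2 * n -> v \notin A ->
  exists2 a : 'I_n, a \notin f @: [set u in A | adj v u] &
    blocked f [set u in A | ~~ adj v u] (~: [set a]).
Proof.
move=> tf blA cardA vA.
set N := [set u in A | adj v u]; set R := [set u in A | ~~ adj v u].
have stN : stable N.
  apply/stableP => x y; rewrite !inE => /andP[_ vx] /andP[_ vy].
  by apply/negP => xy; apply: (tf v x y).
have NA : N \subset A by apply/subsetP => x; rewrite inE => /andP[].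
have RA : R \subset A by apply/subsetP => x; rewrite inE => /andP[].
have [a0 _ a0N] : exists2 a, a \in [set: 'I_n] & a \notin f @: N.
  by apply/subsetPn; apply: blA.
have [C [_ blC cardC]] := blocked_dense (blockedS RA (subxx _) blA).
have [full | /subsetPn[a _]] := boolP ([set: 'I_n] \subset C :|: f @: N); last first.
  rewrite inE negb_or => /andP[aC aN]; exists a => //.
  by apply: blockedS blC => //; apply/subsetP => c cC; rewrite !inE; apply: contraNneq aC => <-.
have {}full c : c \notin C -> c \in f @: N.
  by move=> cC; have := subsetP full c (in_setT c); rewrite inE (negbTE cC).
(* A colour [b] outside [C] and missing on [R] occurs on [N]; hence [b != a0], and [b] still blocks
   [R] when [v] takes [a0]. *)
have [CR | /subsetPn[b]] := boolP (~: C \subset f @: R); last first.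
  rewrite inE => bC bR; exists a0 => // J JR _; apply: contra bR => /subsetP sub.
  apply: subsetP (imsetS f JR) _ (sub b _).
  by rewrite !inE; apply: contraTneq (full b bC) => ->.
(* Otherwise every colour outside [C] occurs on both [N] and [R]. With the [2 * #|C| - 2] vertices
   of [R] coloured in [C], this makes [A] too large. *)
have cardN : #|~: C| <= #|N|.
  apply: leq_trans (leq_imset_card f N); apply/subset_leq_card/subsetP => c.
  by rewrite inE; apply: full.
have cardR : #|~: C| <= #|[set u in R | f u \notin C]|.
  apply: leq_trans (leq_imset_card f _); apply/subset_leq_card/subsetP => c cC.
  have /imsetP[u uR cE] := subsetP CR c cC.
  by apply/imsetP; exists u => //; rewrite inE uR -cE -in_setC.
have := cardsC C; rewrite card_ord => cardT.
have := cardsID N A; have -> : A :&: N = N by apply/setIidPr.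
have -> : A :\: N = R by apply/setP => u; rewrite !inE; case: (u \in A); rewrite ?andbF //= andbT.
have := cardsID [set u | f u \in C] R.
have -> : R :&: [set u | f u \in C] = [set u in R | f u \in C] by apply/setP => u; rewrite !inE.
have -> : R :\: [set u | f u \in C] = [set u in R | f u \notin C].
  by apply/setP => u; rewrite !inE andbC.
lia.
Qed.

Definition proper_on f X := {in X &, forall x y, adj x y -> f x != f y}.

Lemma eq_in_proper_on f f' X : {in X, f =1 f'} -> proper_on f X -> proper_on f' X.
Proof. by move=> ff' pf x y xX yX xy; rewrite -!ff' ?pf. Qed.

Lemma eq_in_blocked f f' X C : {in X, f =1 f'} -> blocked f X C -> blocked f' X C.
Proof.
move=> ff' bl J JX stJ; rewrite -(eq_in_imset (f := f)); first exact: bl.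
by move=> x /(subsetP JX) /ff'.
Qed.

(** The vertices of [B :\: A] are coloured one at a time by [blocked_choice]. A stable set through
    the new vertex [v] that meets all colours would, without [v], lie among non-neighbours of [v]
    and meet all colours other than that of [v], which the choice excludes. *)
Lemma colour_bag f (A B : {set G}) :
  triangle_free G -> A \subset B -> #|B| + 2 <= 2 * n ->
  proper_on f A -> blocked f A setT ->
  exists f', [/\ forall x, x \notin B :\: A -> f' x = f x,
    proper_on f' B & blocked f' B setT].
Proof.
move=> tf AB cardB; move: {2}#|B :\: A| (erefl #|B :\: A|) => m.
elim: m f A AB => [|m IH] f A AB cardBA pf bl.
  have <- : A = B.
    by apply/eqP; rewrite eqEsubset AB -setD_eq0 -cards_eq0 cardBA.
  by exists f.
have [v vBA] : exists v, v \in B :\: A by apply/set0Pn; rewrite -cards_eq0 cardBA.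
have [vA vB] : v \notin A /\ v \in B by apply/andP; rewrite -in_setD.
have cardA : #|A| + 3 <= 2 * n.
  by have := cardsID A B; rewrite (setIidPr AB); lia.
have [a aN blR] := blocked_choice tf bl cardA vA.
pose g x := if x == v then a else f x.
have gA : {in A, f =1 g}.
  by move=> x xA; rewrite /g; case: eqP => // xv; rewrite -xv xA in vA.
have gv : g v = a by rewrite /g eqxx.
have av u : u \in A -> adj v u -> a != g u.
  move=> uA vu; apply: contraNneq aN => ->; apply/imsetP; exists u; rewrite ?inE ?uA //.
  by rewrite gA.
have [|||| f' [f'g pf' bl']] := IH g (v |: A).
- by rewrite subUset sub1set vB.
- by move: cardBA; rewrite (cardsD1 v) vBA setDDl setUC => -[].
- move=> x y; rewrite !inE => /predU1P[->|xA] /predU1P[->|yA] xy.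
  + by rewrite adj_irrefl in xy.
  + by rewrite gv av.
  + by rewrite gv eq_sym av // adj_sym.
  + by apply: (eq_in_proper_on gA pf).
- move=> J JvA stJ; have [vJ | vJ] := boolP (v \in J); last first.
    apply: (eq_in_blocked gA bl) => //; apply/subsetP => x xJ.
    have := subsetP JvA x xJ; rewrite !inE => /predU1P[xv|//].
    by rewrite xv (negbTE vJ) in xJ.
  have JR : J :\ v \subset [set u in A | ~~ adj v u].
    apply/subsetP => x; rewrite !inE => /andP[xv xJ].
    have := subsetP JvA x xJ; rewrite !inE (negbTE xv) /= => -> /=.
    exact: (stableP _ stJ).
  have stJv : stable (J :\ v) by apply: stableS stJ; apply: subsetDl.
  apply: contra (blR _ JR stJv) => /subsetP sub.
  apply/subsetP => c; rewrite !inE => ca.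
  have /imsetP[x xJ cE] := sub c (in_setT c).
  have xv : x != v by apply: contraNneq ca => xv; rewrite cE xv gv.
  by apply/imsetP; exists x; rewrite ?inE ?xv // cE /g (negbTE xv).
exists f'; split=> // x xBA; rewrite f'g.
  by rewrite /g; case: eqP => // xv; rewrite xv vBA in xBA.
by move: xBA; rewrite !inE negb_or; case: (x \in A); case: (x \in B); rewrite ?orbT ?andbF.
Qed.

End Blocked.

(** * Colouring along a tree-decomposition *)

Lemma connect_exit (T : finType) (e : rel T) (P : {set T}) (x y : T) :
  connect e x y -> x \in P -> y \notin P ->
  exists u v, [/\ u \in P, v \notin P & e u v].
Proof.
case/connectP => p; elim: p x => [|z p IH] x /=; first by move=> _ -> ->.
case/andP => xz pz yE xP yP; have [zP | zP] := boolP (z \in P).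
  exact: (IH z).
by exists x, z.
Qed.

Lemma path_induced (G : sgraph) (S : {set G}) (x : G) (p : seq G) :
  path (induced_adj S) x p -> path (@adj G) x p && all (mem S) p.
Proof.
elim: p x => //= y p IH x /andP[/and3P[_ yS xy] /IH /andP[-> ->]].
by rewrite xy yS.
Qed.

Lemma induced_adj_sym (G : sgraph) (S : {set G}) : symmetric (induced_adj S).
Proof. by move=> x y; rewrite /induced_adj /= adj_sym andbCA. Qed.

Lemma connect_induced_sym (G : sgraph) (S : {set G}) :
  connect_sym (induced_adj S).
Proof. exact/sym_connect_sym/induced_adj_sym. Qed.

Lemma connect_inducedS (G : sgraph) (S S' : {set G}) :
  S \subset S' -> subrel (connect (induced_adj S)) (connect (induced_adj S')).
Proof.
move=> /subsetP sub; apply: connect_sub => x y /and3P[xS yS xy].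
by apply: connect1; rewrite /induced_adj /= !sub.
Qed.

Lemma connected_set1 (G : sgraph) (x : G) : connected_in [set x].
Proof.
split; first by apply/set0Pn; exists x; rewrite inE.
by move=> y z /set1P-> /set1P->; apply: connect0.
Qed.

Lemma connected_setU1 (G : sgraph) (S : {set G}) (x y : G) :
  connected_in S -> x \in S -> adj x y -> connected_in (y |: S).
Proof.
move=> [_ conS] xS xy; split; first by apply/set0Pn; exists y; rewrite !inE eqxx.
have conx z : z \in y |: S -> connect (induced_adj (y |: S)) x z.
  move=> /setU1P[->|zS]; first by apply: connect1; rewrite /induced_adj /= !inE eqxx xS orbT.
  by apply: connect_inducedS (conS x z xS zS); apply: subsetUr.
by move=> z w /conx xz /conx; apply: connect_trans; rewrite connect_induced_sym.
Qed.

(* Otherwise a path in [Q] from [t] to [P], closed up inside [P] and through [p], is a cycle. *)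
Lemma tree_gate (T : sgraph) (P Q : {set T}) (p t s : T) :
  acyclic T -> connected_in P -> connected_in Q -> p \in P -> t \notin P ->
  adj p t -> t \in Q -> s \in P -> s \in Q -> p \in Q.
Proof.
move=> acT [_ conP] [_ conQ] pP tP pt tQ sP sQ.
have /connectP[l0 l0P sE] := conQ t s tQ sQ.
case/shortenP: l0P sE => l lP uniql _ sE {l0}.
have hasP : has (mem P) l.
  case: l lP uniql sE => [_ _ /= st|z l _ _ sE]; first by rewrite -st sP in tP.
  by apply/hasP; exists s => //; rewrite sE /= mem_last.
(* [q] is the first vertex of the path in [P], so the part before it is disjoint from any path
   inside [P]. *)
case/split_find: hasP lP uniql sE => q l1 l2 qP nP lP uniql _.
have [<-|qp] := eqVneq q p.
  have /path_induced/andP[_ /allP] := lP; apply.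
  by rewrite mem_cat mem_rcons inE eqxx.
have /connectP[m0 m0P pE] := conP q p qP pP.
case/shortenP: m0P pE => m mP uniqm _ pE {m0}.
have /path_induced/andP[lA _] := lP; have /path_induced/andP[mA mS] := mP.
have : size (t :: l1 ++ q :: m) <= 2.
  apply: acT.
    rewrite /= rcons_cat cat_path /= rcons_path -pE pt mA andbT.
    by move: lA; rewrite cat_rcons cat_path /= => /and3P[-> ->].
  rewrite -cat_cons cat_uniq uniqm andbT; apply/andP; split.
    by move: uniql; rewrite cat_rcons -cat_cons cat_uniq => /andP[].
  apply/hasPn => z; rewrite inE => zm; have {zm} zP : z \in P.
    by case/predU1P: zm => [->|/(allP mS)].
  rewrite !inE negb_or; apply/andP; split; first by apply: contraNneq tP => <-.
  by apply: contra nP => zl; apply/hasP; exists z.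
(* [q != p] makes [m] non-empty, so the cycle has at least three vertices. *)
by case: (m) pE => [/= pE|z m' _]; [rewrite pE eqxx in qp | rewrite /= size_cat /= !addnS].
Qed.

Section UpperBound.

Variables (G : sgraph) (D : tree_decomposition G) (n : nat).

Hypothesis tf : triangle_free G.
Hypothesis width : forall t : td_tree D, #|td_bag t| + 2 <= 2 * n.

(** The subtree [P] grows by one adjacent node [t] at a time. By [tree_gate], the bag of [t] meets
    the bags of [P] only inside the bag of its neighbour [p], so colouring the rest of it leaves all
    earlier bags untouched. *)
Lemma colour_subtree (m : nat) : m < #|td_tree D| ->
  exists (P : {set td_tree D}) (f : G -> 'I_n), [/\ #|P| = m.+1, connected_in P &
    {in P, forall t, proper_on f (td_bag t) /\ blocked f (td_bag t) setT}].
Proof.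
have n0 : 0 < n.
  have [/set0Pn[t _] _] := (td_treeP D).1.
  by have := width t; case: (n) => //; rewrite muln0 addn2.
elim: m => [|m IH] mT.
  have [/set0Pn[t _] _] := (td_treeP D).1.
  have [||||f [_ pf bl]] := @colour_bag G n (fun=> Ordinal n0) set0 (td_bag t) tf.
  - exact: sub0set.
  - exact: width.
  - by move=> x y; rewrite inE.
  - move=> J; rewrite subset0 => /eqP -> _; rewrite imset0 subset0.
    by apply/set0Pn; exists (Ordinal n0).
  - exists [set t], f; rewrite cards1; split=> //; first exact: connected_set1.
    by move=> _ /set1P->.
have [P [f [cardP conP fP]]] := IH (ltnW mT).
have [/set0Pn[s sP] _] := conP.
have [r _ rP] : exists2 r, r \in setT & r \notin P.
  by apply/subsetPn; apply: contraTN mT => /subset_leq_card; rewrite cardsT cardP -leqNgt.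
have [p [t [pP tP /and3P[_ _ pt]]]] :=
  connect_exit ((td_treeP D).1.2 s r (in_setT s) (in_setT r)) sP rP.
have gate v u : v \in td_bag t -> u \in P -> v \in td_bag u -> v \in td_bag p.
  move=> vt uP vu.
  have := tree_gate (td_treeP D).2 conP (td_vertexP D v) pP tP pt _ uP.
  by rewrite !inE; apply.
have [pf bl] := fP p pP.
have [||||f' [f'f pf' bl']] := @colour_bag G n f (td_bag t :&: td_bag p) (td_bag t) tf.
- exact: subsetIl.
- exact: width.
- by move=> x y /setIP[_ xp] /setIP[_ yp]; apply: pf.
- exact: blockedS (subsetIr _ _) (subxx _) bl.
exists (t |: P), f'; split.
- by rewrite cardsU1 tP cardP.
- exact: connected_setU1 pt.
- move=> u /setU1P[->//|uP]; have [pfu blu] := fP u uP.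
  have ff' : {in td_bag u, f =1 f'}.
    move=> v vu; rewrite f'f // !inE; apply/negP => /andP[nvp vt].
    by rewrite vt (gate v u) in nvp.
  by split; [apply: eq_in_proper_on ff' pfu | apply: eq_in_blocked ff' blu].
Qed.

Lemma triangle_free_colourable : exists f : colouring G n, Defs.proper f.
Proof.
have [/set0Pn[t _] _] := (td_treeP D).1.
have T0 : 0 < #|td_tree D| by apply/card_gt0P; exists t.
have [|P [f [cardP _ fP]]] := @colour_subtree #|td_tree D|.-1; first by rewrite prednK.
have PT : P = setT.
  by apply/eqP; rewrite eqEcard subsetT cardP cardsT prednK ?leqnn.
exists [ffun x => f x]; apply/forallP => x; apply/forallP => y; apply/implyP => xy.
have [u [xu yu]] := td_edgeP D xy.
by rewrite !ffunE; apply: (fP u _).1; rewrite ?PT ?inE.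
Qed.

End UpperBound.

(** * Hanging leaves off a tree-decomposition *)

Section Extension.

Variables (G : sgraph) (Q : finType) (N : Q -> {set G}).

(** Used twice: for graphs, and for the trees of decompositions, where each [N q] is a singleton and
    the new vertices are leaves. *)
Definition ext_adj : rel (G + Q) := fun a b =>
  match a, b with
  | inl x, inl y => adj x y
  | inl x, inr q | inr q, inl x => x \in N q
  | inr _, inr _ => false
  end.

Lemma ext_adj_sym : symmetric ext_adj.
Proof. by move=> [x|q] [y|r] //=; apply: adj_sym. Qed.

Lemma ext_adj_irrefl : irreflexive ext_adj.
Proof. by move=> [x|q] //=; apply: adj_irrefl. Qed.

Definition ext : sgraph := SGraph ext_adj_sym ext_adj_irrefl.

Lemma ext_triangle_free :
  triangle_free G -> (forall q, stable (N q)) -> triangle_free ext.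
Proof.
move=> tf st [x|q] [y|r] [z|s] /= [] //.
- by move=> xy yz xz; apply: (tf x y z).
- by move=> xy yN xN; have := stableP _ (st s) x y xN yN; rewrite xy.
- by move=> xN yN xy; have := stableP _ (st r) x z xN yN; rewrite xy.
- by move=> xN xy yN; have := stableP _ (st q) y z xN yN; rewrite xy.
Qed.

Lemma stable_inl (S : {set G}) : stable S -> stable (inl @: S : {set ext}).
Proof.
by move=> /stableP st; apply/stableP => _ _ /imsetP[x xS ->] /imsetP[y yS ->]; apply: st.
Qed.

Lemma connect_inl (S : {set G}) (S' : {set ext}) :
  (forall x, x \in S -> inl x \in S') -> forall x y,
  connect (induced_adj S) x y -> connect (induced_adj S') (inl x) (inl y).
Proof.
move=> sub x y /connectP[p]; elim: p x => [|z p IH] x /=.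
  by move=> _ ->; apply: connect0.
case/andP => /and3P[xS zS xz] zp yE; apply: connect_trans (IH z zp yE).
by apply: connect1; rewrite /induced_adj /= !sub.
Qed.

Lemma connected_ext (S : {set G}) (S' : {set ext}) :
  connected_in S -> (forall x, (inl x \in S') = (x \in S)) ->
  (forall q, inr q \in S' -> exists2 x, x \in S & x \in N q) -> connected_in S'.
Proof.
move=> [/set0Pn[x0 x0S] conS] inlS inrS; split.
  by apply/set0Pn; exists (inl x0); rewrite inlS.
have conx0 a : a \in S' -> connect (induced_adj S') (inl x0) a.
  have old x : x \in S -> connect (induced_adj S') (inl x0) (inl x).
    by move=> xS; apply: connect_inl (conS x0 x x0S xS) => // y; rewrite inlS.
  case: a => [x|q] aS; first by apply: old; rewrite -inlS.
  have [x xS xN] := inrS q aS; apply: connect_trans (old x xS) (connect1 _).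
  by rewrite /induced_adj /= inlS xS aS.
by move=> a b /conx0 x0a /conx0; apply: connect_trans; rewrite connect_induced_sym.
Qed.

End Extension.

Section ExtendTree.

Variables (T : sgraph) (Q : finType) (att : Q -> T).

Definition ext_tree : sgraph := ext (fun q => [set att q]).

(** On a cycle through a new leaf [q], both neighbours of [q] equal [inl (att q)], so the cycle is
    degenerate. Any other cycle lies in [T]. *)
Lemma ext_tree_acyclic : acyclic T -> acyclic ext_tree.
Proof.
move=> acT c cyc uniqc.
have [/hasP[[//|q] qc _] | old] := boolP (has (fun a => if a is inr _ then true else false) c).
  have [i s rotc] := rot_to qc.
  have {uniqc} : uniq (inr q :: s) by rewrite -rotc rot_uniq.
  have {cyc} : cycle (@adj ext_tree) (inr q :: s) by rewrite -rotc rot_cycle.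
  rewrite -(size_rot i c) {}rotc /=; case: s => [//|a s] /=.
  rewrite rcons_path => /and3P[qa _].
  case: s => [//|b s] /= lq /and3P[_ + _].
  have /= lbs := mem_last b s; move: (last b s) lbs lq => e; move: qa.
  by case: a e => [x|r] [y|r'] //= /set1P -> ins /set1P yE; rewrite -yE ins.
have {old} [c' cE] : exists c' : seq T, c = map inl c'.
  elim: c {cyc uniqc} old => [|[x|q] c IH] //=; first by exists [::].
  by case/IH => c' ->; exists (x :: c').
rewrite {c}cE size_map in cyc uniqc *; apply: acT.
  by rewrite (mono_cycle (e := @adj T) (e' := @adj ext_tree)) in cyc.
by move: uniqc; rewrite map_inj_uniq // => x y [].
Qed.

Lemma ext_tree_is_tree : is_tree T -> is_tree ext_tree.
Proof.
move=> [conT acT]; split; last exact: ext_tree_acyclic.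
apply: connected_ext conT _ _ => [x|q _]; first by rewrite !inE.
by exists (att q); rewrite ?inE.
Qed.

End ExtendTree.

Section ExtendDecomposition.

Variables (G : sgraph) (D : tree_decomposition G) (Q : finType).
Variables (att : Q -> td_tree D) (A N : Q -> {set G}).

Hypothesis A_bag : forall q, A q \subset td_bag (att q).
Hypothesis N_sub : forall q, N q \subset A q.

(** [A q] may exceed the neighbourhood [N q]: it is the part of the old bag carried along so that
    later extensions can still attach to it. *)
Definition ext_bag (t : ext_tree att) : {set ext N} :=
  match t with
  | inl t => inl @: td_bag t
  | inr q => inr q |: (inl @: A q)
  end.

Let inl_inj : injective (@inl G Q). Proof. by move=> x y []. Qed.

Lemma inr_inl (q : Q) (S : {set G}) : (inr q \in [set inl x | x in S]) = false.
Proof. by apply/imsetP => -[]. Qed.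

Lemma ext_vertexP (v : ext N) : connected_in [set t | v \in ext_bag t].
Proof.
case: v => [x|q].
  apply: connected_ext (td_vertexP D x) _ _ => [t|q].
    by rewrite !inE /= mem_imset.
  rewrite !inE /= mem_imset // => xA; exists (att q); rewrite !inE //.
  exact: subsetP (A_bag q) x xA.
have -> : [set t | inr q \in ext_bag t] = [set inr q]; last exact: connected_set1.
apply/setP => -[t|r]; rewrite !inE /= ?inr_inl //.
by rewrite orbF eq_sym.
Qed.

Lemma ext_edgeP (x y : ext N) : adj x y ->
  exists t : ext_tree att, x \in ext_bag t /\ y \in ext_bag t.
Proof.
case: x y => [x|q] [y|r] //=.
- by move=> /(td_edgeP D)[t [xt yt]]; exists (inl t); rewrite /= !mem_imset.
- move=> /(subsetP (N_sub r)) xA; exists (inr r).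
  by rewrite /= !inE eqxx mem_imset // xA orbT.
- move=> /(subsetP (N_sub q)) yA; exists (inr q).
  by rewrite /= !inE eqxx mem_imset // yA orbT.
Qed.

Definition ext_td : tree_decomposition (ext N) :=
  TreeDecomposition (ext_tree_is_tree att (td_treeP D)) ext_vertexP ext_edgeP.

Lemma card_ext_bag (t : ext_tree att) (w : nat) :
  (forall t, #|@td_bag G D t| <= w.+1) -> (forall q, #|A q| <= w) -> #|ext_bag t| <= w.+1.
Proof.
move=> bagw Aw; case: t => [t|q] /=; first by rewrite card_imset.
by rewrite cardsU1 inr_inl card_imset // add1n ltnS.
Qed.

End ExtendDecomposition.

(** * Forcing colours *)

(** Defect without components, for plain functions, so that it passes to induced subgraphs by
    composition with an embedding. *)
Definition defective (G : sgraph) n (f : G -> 'I_n) (d : nat) : Prop :=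
  forall u, #|[set v | adj u v && (f v == f u)]| <= d.

Lemma card_bigcup_leq (T I : finType) (N : {set I}) (F : I -> {set T}) (d : nat) :
  (forall i, #|F i| <= d) -> #|\bigcup_(i in N) F i| <= #|N| * d.
Proof.
move=> Fd; rewrite -sum_nat_const; elim/big_rec2: _ => [|i m S _ Sm].
  by rewrite cards0.
by apply: leq_trans (leq_card_setU _ _) _; rewrite leq_add.
Qed.

(* Every [N] is answered by more vertices than could share a colour with [N]. *)
Lemma forcing_extension (G : sgraph) (D : tree_decomposition G) (k n d : nat) :
  triangle_free G -> (forall t, #|@td_bag G D t| <= k.+1) ->
  exists (G' : sgraph) (D' : tree_decomposition G') (i : G -> G'),
  [/\ triangle_free G', forall t, #|@td_bag G' D' t| <= k.+1, injective i,
      forall x y, adj (i x) (i y) = adj x y &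
      forall (f : G' -> 'I_n) (t : td_tree D) (A N : {set G}), defective f d ->
        A \subset td_bag t -> N \subset A -> stable N -> #|A| <= k ->
        exists (v : G') (t' : td_tree D'),
        [/\ forall x, i x != v, v |: (i @: A) \subset td_bag t',
            forall x, adj v (i x) = (x \in N) & f v \notin f @: (i @: N)]].
Proof.
move=> tf bagk.
(* New vertices are indexed by a node, the carried part of its bag, a neighbourhood, and one of
   [k * d + 1] copy numbers. *)
pose ok (q : td_tree D * {set G} * {set G} * 'I_(k * d).+1) :=
  [&& q.1.1.2 \subset td_bag q.1.1.1, q.1.2 \subset q.1.1.2, stable q.1.2 & #|q.1.1.2| <= k].
pose Q := {q | ok q}.
pose att (q : Q) := (val q).1.1.1; pose A (q : Q) := (val q).1.1.2; pose N (q : Q) := (val q).1.2.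
have A_bag q : A q \subset td_bag (att q) by have /and4P[] := valP q.
have N_sub q : N q \subset A q by have /and4P[] := valP q.
have N_st q : stable (N q) by have /and4P[] := valP q.
have Ak q : #|A q| <= k by have /and4P[] := valP q.
exists (ext N), (ext_td A_bag N_sub), inl; split.
- exact: ext_triangle_free.
- by move=> t; apply: card_ext_bag.
- by move=> x y [].
- by [].
move=> f t B S fd Bt SB stS Bk.
have okm m : ok (t, B, S, m) by apply/and4P.
pose q m : Q := exist _ (t, B, S, m) (okm m).
(* If every copy repeated a colour of [S], each would be a neighbour of some vertex of [S] in its
   own colour, and there are at most [k * d] of those. *)
have [m fm] : exists m, f (inr (q m)) \notin f @: (inl @: S : {set ext N}).
  apply/existsP; apply: contraT; rewrite negb_exists => /forallP all_in.
  pose F u := [set v : ext N | adj (inl u : ext N) v && (f v == f (inl u))].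
  have sub : [set (inr (q m) : ext N) | m in 'I_(k * d).+1] \subset \bigcup_(u in S) F u.
    apply/subsetP => _ /imsetP[m _ ->]; have := all_in m; rewrite negbK.
    case/imsetP => _ /imsetP[u uS ->] fE; apply/bigcupP; exists u => //.
    by rewrite inE /= fE eqxx andbT.
  have := subset_leq_card sub; rewrite card_imset => [|m1 m2 []]; last by [].
  rewrite card_ord => lt.
  have le : #|\bigcup_(u in S) F u| <= #|S| * d by apply: card_bigcup_leq => u; apply: fd.
  have Sk : #|S| <= k := leq_trans (subset_leq_card SB) Bk.
  have := leq_trans lt le; rewrite ltnNge leq_mul2r; lia.
exists (inr (q m)), (inr (q m)); split=> //=; exact: subxx.
Qed.

(* [W] is being built next to [I], in colours of [I], so that a new colour given to a vertex
   adjacent to exactly the vertices of [I] whose colours occur in [W] can be added both to [W]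
   and to the rest of [I]. *)
Definition ladder (G : sgraph) n (f : G -> 'I_n) (B I W : {set G}) : Prop :=
  [/\ I :|: W \subset B, [disjoint I & W], stable I & {in I &, injective f}] /\
  [/\ {in W &, injective f}, f @: W \subset f @: I &
      stable (W :|: [set u in I | f u \notin f @: W])].

Lemma stable_imset (G G' : sgraph) (i : G -> G') (S : {set G}) :
  (forall x y, adj (i x) (i y) = adj x y) -> stable S -> stable (i @: S).
Proof.
move=> iadj /stableP st; apply/stableP => _ _ /imsetP[x xS ->] /imsetP[y yS ->].
by rewrite iadj st.
Qed.

Lemma stableU1 (G : sgraph) (S : {set G}) (v : G) :
  stable S -> {in S, forall x, ~~ adj v x} -> stable (v |: S).
Proof.
move=> /stableP st vS; apply/stableP => x y /setU1P[->|xS] /setU1P[->|yS].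
- by rewrite adj_irrefl.
- exact: vS.
- by rewrite adj_sym vS.
- exact: st.
Qed.

Lemma injectiveU1 (G : sgraph) n (f : G -> 'I_n) (S : {set G}) (v : G) :
  {in S &, injective f} -> f v \notin f @: S -> {in v |: S &, injective f}.
Proof.
move=> inj fv x y /setU1P[->|xS] /setU1P[->|yS] // fE; last exact: inj.
  by case/imsetP: fv; exists y.
by case/imsetP: fv; exists x.
Qed.

(** Encodes the lexicographic order on pairs whose second entry is at most [n]. *)
Definition rank n (c w : nat) := c * n.+1 + w.

Section Climb.

Variables (G G' : sgraph) (n : nat) (i : G -> G') (f : G' -> 'I_n).
Hypothesis i_inj : injective i.
Hypothesis i_adj : forall x y, adj (i x) (i y) = adj x y.

(** [N] has exactly the colours of [W], so the colour of [v] is new to [W]. If it occurs on [I],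
    then [v] joins [W]. Otherwise [v], [W] and [R] form a stable set with distinct colours, which
    replaces [I]; it has one more vertex because [W] stands in for [N]. *)
Lemma ladder_climb (B I W : {set G}) (B' : {set G'}) (v : G') :
  ladder (f \o i) B I W -> (forall x, i x != v) ->
  v |: (i @: (I :|: W)) \subset B' ->
  (forall x, adj v (i x) = (x \in [set u in I | f (i u) \in (f \o i) @: W])) ->
  f v \notin f @: (i @: [set u in I | f (i u) \in (f \o i) @: W]) ->
  exists I' W', ladder f B' I' W' /\ rank n #|I| #|W| < rank n #|I'| #|W'|.
Proof.
move=> [[_ IW stI injI] [injW fWI stW]] iv B'sub vadj fvN.
set N := [set u in I | _] in vadj fvN.
set R := [set u in I | _] in stW.
have vi (S : {set G}) : v \notin i @: S by apply/imsetP => -[x _ vE]; have := iv x; rewrite vE eqxx.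
have fi (S : {set G}) : f @: (i @: S) = (f \o i) @: S by rewrite -imset_comp.
have injf (S : {set G}) : {in S &, injective (f \o i)} -> {in i @: S &, injective f}.
  by move=> injS _ _ /imsetP[x xS ->] /imsetP[y yS ->] /injS ->.
have fN : f @: (i @: N) = f @: (i @: W).
  apply/eqP; rewrite !fi eqEsubset; apply/andP; split; apply/subsetP => c.
    by case/imsetP => u; rewrite inE => /andP[_ uW] ->.
  move=> cW; have /imsetP[u uI cE] := subsetP fWI c cW.
  by apply/imsetP; exists u; rewrite // inE uI -[f (i u)]cE.
have vR x : x \in W :|: R -> ~~ adj v (i x).
  rewrite vadj !inE => /orP[xW|/andP[_ /negbTE ->]]; last by rewrite andbF.
  by have /disjointFl -> := IW.
have vWR : stable (v |: i @: (W :|: R)).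
  apply: stableU1 (stable_imset i_adj stW) _ => _ /imsetP[x xWR ->].
  exact: vR.
have cardI : #|i @: I| = #|I| by rewrite card_imset.
have cardW : #|v |: i @: W| = #|W|.+1 by rewrite cardsU1 vi card_imset.
have fvW : f v \notin f @: (i @: W) by rewrite -fN.
have [fvI | fvI] := boolP (f v \in f @: (i @: I)).
  exists (i @: I), (v |: i @: W); split; last first.
    by rewrite /rank cardI cardW addnS.
  split; split.
  - by rewrite setUCA -imsetU.
  - apply/pred0P => x /=; apply/negP => /andP[/imsetP[y yI ->] /setU1P[/eqP yv|]].
      by rewrite (negbTE (iv y)) in yv.
    by rewrite mem_imset // (disjointFr IW yI).
  - exact: stable_imset.
  - exact: injf.
  - by apply: injectiveU1 => //; apply: injf.
  - by rewrite imsetU1 subUset sub1set fvI !fi.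
  - apply: stableS vWR; rewrite (imsetU i) setUA; apply: setUS.
    apply/subsetP => _ /setIdP[/imsetP[u uI ->]].
    rewrite imsetU1 inE negb_or => /andP[_ fuW].
    by rewrite mem_imset // inE uI -fi.
exists (v |: i @: (W :|: R)), set0; split.
  split; split.
  - rewrite setU0; apply: subset_trans B'sub; apply: setUS; apply: imsetS.
    by rewrite setUC setSU //; apply/subsetP => u; rewrite inE => /andP[].
  - by apply/pred0P => x /=; rewrite in_set0 andbF.
  - exact: vWR.
  - apply: injectiveU1.
      apply: injf => x y /setUP[xW|xR] /setUP[yW|yR] fE; first exact: injW.
      + by case/setIdP: yR => _ /imsetP[]; exists x.
      + by case/setIdP: xR => _ /imsetP[]; exists y.
      + by apply: injI fE; [move: xR | move: yR]; rewrite inE => /andP[].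
    rewrite imsetU imsetU inE negb_or fvW.
    apply: contra fvI; apply: subsetP; apply/imsetS/imsetS.
    by apply/subsetP => u; rewrite inE => /andP[].
  - by move=> x y; rewrite inE.
  - by rewrite imset0 sub0set.
  - rewrite set0U; apply: stableS vWR; apply/subsetP => u; rewrite inE => /andP[//].
rewrite cardsU1 vi card_imset // cards0.
have WR : [disjoint W & R].
  by rewrite disjoint_sym; apply: disjointWl IW; apply/subsetP => u; rewrite inE => /andP[].
have cardN : #|N| = #|W|.
  rewrite -(card_in_imset injW) -(fi W) -fN fi card_in_imset //.
  by move=> x y /setIdP[xI _] /setIdP[yI _]; apply: injI.
have cardNR : #|N| + #|R| = #|I|.
  rewrite -(cardsID [set u | f (i u) \in (f \o i) @: W] I).
  by congr (_ + _); apply: eq_card => u; rewrite !inE // andbC.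
have cWR : #|W :|: R| = #|I|.
  by move: WR; rewrite -(leq_card_setU W R) => /eqP ->; rewrite -cardN.
(* Resetting [W] to the empty set costs at most [n], less than the [n.+1] gained from [I]. *)
have Wn : #|W| <= n.
  by rewrite -(card_in_imset injW) -[X in _ <= X]card_ord max_card.
rewrite /rank cWR; lia.
Qed.

End Climb.

Lemma leq_card_ladder (G : sgraph) n (f : G -> 'I_n) (B I W : {set G}) :
  ladder f B I W -> #|W| <= #|I| <= n.
Proof.
move=> [[_ _ _ injI] [injW WI _]].
rewrite -(card_in_imset injI) -(card_in_imset injW) subset_leq_card //=.
by rewrite -[X in _ <= X]card_ord max_card.
Qed.

Definition void_graph : sgraph :=
  @SGraph void (fun _ _ => false) (fun _ _ => erefl) (fun _ => erefl).

(** Ladders have bounded rank, so a large [m] excludes colourings of defect [d]. One forcing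
    extension answers all possible ladders at once, so the graph does not depend on the colouring,
    and each round raises the rank. *)
Lemma forced_ladder (k n d m : nat) : 0 < n <= k -> n.-1.*2 <= k ->
  exists (G : sgraph) (D : tree_decomposition G),
  [/\ triangle_free G, forall t, #|@td_bag G D t| <= k.+1 &
      forall f : G -> 'I_n, defective f d ->
        exists t I W, ladder f (@td_bag G D t) I W /\ m <= rank n #|I| #|W|].
Proof.
case/andP => n0 nk n2k; elim: m => [|m [G [D [tf bagk climb]]]].
  (* The start is the empty graph with a single empty bag and [I = W = set0]. *)
  exists void_graph, (trivial_td void_graph); split=> [[]|t|f _].
    by rewrite /= eq_card0 // => -[].
  exists tt, set0, set0; split=> //; split; split.
  - by rewrite setU0 sub0set.
  - by apply/pred0P => -[].
  - by apply/stableP => -[].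
  - by move=> [].
  - by move=> [].
  - by rewrite imset0 sub0set.
  - by apply/stableP => -[].
have [G' [D' [i [tf' bagk' i_inj i_adj answer]]]] := forcing_extension n d tf bagk.
exists G', D'; split=> // f fd.
have fid : defective (f \o i) d.
  move=> u; apply: leq_trans (fd (i u)); rewrite -(card_imset _ i_inj).
  apply/subset_leq_card/subsetP => _ /imsetP[v + ->].
  by rewrite !inE i_adj.
have [t [I [W [lad mrank]]]] := climb _ fid.
have /andP[WI In] := leq_card_ladder lad.
have [[IWB IW stI injI] _] := lad.
have IB : I \subset td_bag t := subset_trans (subsetUl _ _) IWB.
(* If [I] carries all [n] colours, a vertex answering [N = I] would have no colour left. *)
move: In; rewrite leq_eqVlt => /predU1P[In | In].
  have Ik : #|I| <= k by rewrite In.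
  have [v [_ [_ _ _ /negP[]]]] := answer f t I I fd IB (subxx _) stI Ik.
  suff -> : f @: (i @: I) = setT by rewrite inE.
  apply/eqP; rewrite eqEcard subsetT cardsT card_ord -imset_comp card_in_imset //.
  by rewrite In leqnn.
set N := [set u in I | f (i u) \in (f \o i) @: W].
have NI : N \subset I by apply/subsetP => u /setIdP[].
(* Now [#|W| <= #|I| <= n.-1], which is where [n.-1.*2 <= k] enters. *)
have IWk : #|I :|: W| <= k.
  apply: leq_trans (leq_card_setU _ _) _; lia.
have [v [t' [iv sub vadj fv]]] :=
  answer f t (I :|: W) N fd IWB (subset_trans NI (subsetUl _ _)) (stableS NI stI) IWk.
have [I' [W' [lad' lt]]] := ladder_climb i_inj i_adj lad iv sub vadj fv.
by exists t', I', W'; split=> //; apply: leq_ltn_trans mrank lt.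
Qed.

Lemma not_defective_colourable (k n d : nat) : 0 < n <= k -> n.-1.*2 <= k ->
  exists G, triangle_free_tw k G /\ forall f : G -> 'I_n, ~ defective f d.
Proof.
move=> nk n2k.
(* The target exceeds [rank n n n], the largest rank of a ladder. *)
have [G [D [tf bagk climb]]] := forced_ladder d (rank n n n).+1 nk n2k.
exists G; split; last first.
  move=> f /climb[t [I [W [/leq_card_ladder/andP[WI In]]]]].
  by rewrite ltnNge leq_add ?leq_mul // (leq_trans WI).
split=> //; rewrite /treewidth; case: ex_minnP => w _ min.
apply: leq_trans (min (td_width D) _) _; first by apply/asboolP; exists D.
rewrite /td_width -subn1 leq_subLR add1n; exact/bigmax_leqP.
Qed.

(** * Defect, clustering and properness; the three chromatic numbers *)

Lemma has_defect_defective (G : sgraph) n (f : colouring G n) d :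
  has_defect f d -> defective f d.
Proof.
move=> fd u.
set S := colour_class f (f u).
have uS : u \in S by rewrite inE.
set C := [set y | connect (induced_adj S) u y].
have Cd : max_degree_in C <= d.
  by apply: fd; exists (f u); apply/imsetP; exists u.
apply: leq_trans Cd; apply: leq_trans (_ : #|[set y in C | adj u y]| <= _).
  apply/subset_leq_card/subsetP => v /setIdP; rewrite !inE => -[uv fv]; rewrite uv andbT.
  by apply: connect1; rewrite /induced_adj /= uS inE fv.
by apply: (leq_bigmax_cond (F := fun x => #|[set y in C | adj x y]|)); rewrite inE connect0.
Qed.

Lemma has_clustering_defect (G : sgraph) n (f : colouring G n) c :
  has_clustering f c -> has_defect f c.
Proof.
move=> fc C /fc; apply: leq_trans; apply/bigmax_leqP => x _.
by apply/subset_leq_card/subsetP => y; rewrite inE => /andP[].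
Qed.

Lemma proper_clustering (G : sgraph) n (f : colouring G n) :
  Defs.proper f -> has_clustering f 1.
Proof.
move=> /forallP pf C [c /imsetP[x xS ->]].
rewrite -(cards1 x); apply/subset_leq_card/subsetP => y; rewrite !inE.
case/connectP => -[_ -> //|z p /= /andP[/and3P[]]].
rewrite !inE => /eqP fx /eqP fz xz.
by have := pf x => /forallP/(_ z); rewrite xz fx fz eqxx.
Qed.

(** The lower bound concerns a fixed number of colours; this transfers it to all smaller numbers. *)
Lemma widen_defective (G : sgraph) m n (f : colouring G m) d (mn : m <= n) :
  has_defect f d -> defective (widen_ord mn \o f) d.
Proof.
by move/has_defect_defective => fd u; apply: leq_trans (fd u).
Qed.

Lemma ex_proper_colouring (k n : nat) (G : sgraph) : k + 3 <= 2 * n ->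
  triangle_free_tw k G -> exists f : colouring G n, Defs.proper f.
Proof.
move=> kn [tf]; rewrite /treewidth; case: ex_minnP => w /asboolP[D <-] _ Dk.
apply: (triangle_free_colourable (D := D)) => // t.
have : #|td_bag t| <= \max_(t : td_tree D) #|td_bag t| by apply: leq_bigmax.
(* Width at most [k] means bags of at most [k + 1] vertices, and [k + 1 + 2 <= 2 * n]. *)
by move: Dk; rewrite /td_width; lia.
Qed.

(* [uphalf n] is the ceiling of n / 2. *)
Theorem corollary14 (k : nat) (hk : 1 <= k) :
  [/\ is_defective_chromatic_number (triangle_free_tw k) (uphalf (k + 3)),
      is_clustered_chromatic_number (triangle_free_tw k) (uphalf (k + 3)) &
      is_chromatic_number (triangle_free_tw k) (uphalf (k + 3))].
Proof.
set n := uphalf (k + 3).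
have kn : k + 3 <= 2 * n by rewrite /n; lia.
have upper G : triangle_free_tw k G -> exists f : colouring G n, Defs.proper f.
  exact: ex_proper_colouring.
(* One graph for each [d] serves all three numbers, since clustering [c] implies defect [c] and
   properness implies clustering 1. *)
have lower d : exists G, triangle_free_tw k G /\
    forall m (f : colouring G m), has_defect f d -> n <= m.
  have [||G [GK nodef]] := @not_defective_colourable k n.-1 d; [rewrite /n; lia..|].
  exists G; split=> // m f fd; rewrite leqNgt; apply/negP => mn.
  have mn' : m <= n.-1 by move: mn; lia.
  exact: nodef (widen_defective mn' fd).
have chi_upper G : triangle_free_tw k G -> chi G <= n.
  move=> /upper[f pf]; rewrite /chi; case: ex_minnP => m _; apply.
  by apply/existsP; exists f.
split.
- split=> [|m [d md]].
    exists 1 => G /upper[f pf]; exists f.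
    exact/has_clustering_defect/proper_clustering.
  by have [G [GK nodef]] := lower d; have [f /nodef] := md G GK.
- split=> [|m [c mc]].
    by exists 1 => G /upper[f pf]; exists f; apply: proper_clustering.
  have [G [GK nodef]] := lower c; have [f /has_clustering_defect] := mc G GK.
  exact: nodef.
- split=> [|m [G [GK <-]]]; last exact: chi_upper.
  have [G [GK nodef]] := lower 1; exists G; split=> //.
  apply/eqP; rewrite eqn_leq chi_upper //=.
  rewrite /chi; case: ex_minnP => m /existsP[f pf] _.
  exact/(nodef _ f)/has_clustering_defect/proper_clustering.
Qed.
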